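(* Let $X\sim \mathcal{N}_m(\mu,\Sigma)$ with $\mu\in\mathbb{R}^m$ and $\Sigma$ a positive definite $m\times m$ matrix, and let $K=\Sigma^{-1}$. Then $X$ is conditionally increasing in sequence (CIS) if and only if $K=UU^\top$ for some upper triangular $m\times m$ real matrix $U$ with positive diagonal entries and non-positive off-diagonal entries.
   Context: CIS: a random vector $X=(X_1,\ldots,X_m)$ is conditionally increasing in sequence if for every $i\in\{1,\ldots,m\}$ and every fixed $x_i\in\mathbb{R}$, the function $(x_1,\ldots,x_{i-1})\mapsto \mathbb{P}(X_i\ge x_i\mid X_j=x_j \text{ for all } j<i)$ is non-decreasing in each coordinate. For Gaussian vectors with positive definite covariance the conditional law is the usual Gaussian conditional distribution (the continuous version). *)

(* Defs.v *)
From HB Require Import structures.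
From mathcomp Require Import all_boot all_order all_algebra.
From mathcomp Require Import all_classical all_reals all_analysis.
Import Order.TTheory GRing.Theory Num.Theory.
Import numFieldNormedType.Exports.

Set Implicit Arguments.
Unset Strict Implicit.
Unset Printing Implicit Defensive.

Local Open Scope classical_set_scope.
Local Open Scope ring_scope.

Section tuple_lebesgue.
Context {R : realType}.

Definition tcons n (z : measurableTypeR R * n.-tuple R) : n.+1.-tuple R :=
  [tuple of z.1 :: z.2].

Lemma measurable_tcons n :
  measurable_fun [set: measurableTypeR R * n.-tuple R] (@tcons n).
Proof. exact: measurable_cons. Qed.

HB.instance Definition _ n :=
  isMeasurableFun.Build _ _ _ _ (@tcons n) (@measurable_tcons n).

Section step.
Context n (nu : {sigma_finite_measure set (n.-tuple R) -> \bar R}).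

Definition lebesgue_step : set (n.+1.-tuple R) -> \bar R :=
  pushforward (lebesgue_measure \x nu)%E (@tcons n).

Let lebesgue_step0 : lebesgue_step set0 = 0%E.
Proof. exact: measure0. Qed.

Let lebesgue_step_ge0 A : (0 <= lebesgue_step A)%E.
Proof. exact: measure_ge0. Qed.

Let lebesgue_step_sigma_additive : semi_sigma_additive lebesgue_step.
Proof. by apply: measure_semi_sigma_additive; exact: measurable_tcons. Qed.

HB.instance Definition _ := isMeasure.Build _ _ _ lebesgue_step
  lebesgue_step0 lebesgue_step_ge0 lebesgue_step_sigma_additive.

Let lebesgue_step_sigma_finite : sigma_finite setT lebesgue_step.
Proof.
have /sigma_finiteP[F [TF ndF Foo]] := sigma_finiteT (@lebesgue_measure R).
have /sigma_finiteP[G [TG ndG Goo]] := sigma_finiteT nu.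
pose g (t : n.+1.-tuple R) : measurableTypeR R * n.-tuple R :=
  (thead t, [tuple of behead t]).
have gK : cancel (@tcons n) g.
  by case=> x t; rewrite /g /tcons theadE; congr pair; exact/val_inj.
have mg : measurable_fun setT g.
  by apply: measurable_fun_pair; [exact: measurable_tnth|exact: measurable_behead].
exists (fun k => g @^-1` (F k `*` G k)).
  rewrite -preimage_bigcup -(preimage_setT g); congr (_ @^-1` _).
  apply/esym; rewrite -subTset => -[x y] _.
  have [i _ Fx] : (\bigcup_i F i) x by rewrite -TF.
  have [j _ Gy] : (\bigcup_i G i) y by rewrite -TG.
  exists (maxn i j) => //; split => /=.
  - by move: x Fx; exact/subsetPset/ndF/leq_maxl.
  - by move: y Gy; exact/subsetPset/ndG/leq_maxr.
move=> k; have [mF Fk] := Foo k; have [mG Gk] := Goo k; split.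
  by rewrite -[_ @^-1` _]setTI; apply: mg => //; exact: measurableX.
rewrite /lebesgue_step /pushforward -comp_preimage (_ : g \o _ = id).
  by rewrite preimage_id product_measure1E// lte_mul_pinfty// ge0_fin_numE.
by apply/funext => z; exact: gK.
Qed.

HB.instance Definition _ := Measure_isSigmaFinite.Build _ _ _
  lebesgue_step lebesgue_step_sigma_finite.

End step.

(* Lebesgue measure on R^n: the n-fold product, carried by n.-tuple R; for
   n = 0 it is the unit mass at the empty tuple. *)
Fixpoint tuple_lebesgue n : {sigma_finite_measure set (n.-tuple R) -> \bar R} :=
  match n with
  | 0 => dirac [tuple]
  | n'.+1 => lebesgue_step (tuple_lebesgue n')
  end.

End tuple_lebesgue.

Section gaussian.
Context {R : realType}.

Definition posdefmx m (S : 'M[R]_m) : Prop :=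
  S^T = S /\ forall v : 'cV[R]_m, v != 0 -> 0 < (v^T *m S *m v) ord0 ord0.

Definition gaussian_pdf m (mu : 'cV[R]_m) (S : 'M[R]_m) (x : m.-tuple R) : R :=
  let y := \col_j tnth x j - mu in
  (Num.sqrt ((pi *+ 2) ^+ m * \det S))^-1 *
  expR (- (y^T *m invmx S *m y) ord0 ord0 / 2).

(* The law N_m(mu, S), for S positive definite. *)
Definition gaussian_vector d (T : measurableType d) (P : probability T R) m
    (X : {RV P >-> m.-tuple R}) (mu : 'cV[R]_m) (S : 'M[R]_m) : Prop :=
  forall A : set (m.-tuple R), measurable A ->
    distribution P X A =
    (\int[tuple_lebesgue m]_(x in A) (gaussian_pdf mu S x)%:E)%E.

End gaussian.

Section cis.
Context d (T : measurableType d) (R : realType) (P : probability T R) (m : nat).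
Implicit Type X : {RV P >-> m.-tuple R}.

(* (X_j) for j < i *)
Definition past X (i : 'I_m) (w : T) : i.-tuple R :=
  [tuple tnth (X w) (widen_ord (ltnW (ltn_ord i)) j) | j < i].

(* g is a version of x |-> P(X_i >= t | X_j = x_j for all j < i):
   P(X_i >= t, past in B) = E[g(past); past in B] for all Borel B. *)
Definition cond_survival X (i : 'I_m) (t : R) (g : i.-tuple R -> R) : Prop :=
  measurable_fun setT g /\
  forall B : set (i.-tuple R), measurable B ->
    P (past X i @^-1` B `&` [set w | t <= tnth (X w) i]) =
    (\int[P]_(w in past X i @^-1` B) (g (past X i w))%:E)%E.

(* Continuity for the usual topology of R^n, which the library puts on
   'rV[R]_n but not on n.-tuple R. *)
Definition tuple_continuous n (g : n.-tuple R -> R) : Prop :=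
  continuous (fun v : 'rV[R]_n => g [tuple v ord0 j | j < n]).

Definition coordinatewise_nondecreasing n (g : n.-tuple R -> R) : Prop :=
  forall (j : 'I_n) (x y : n.-tuple R),
    (forall k, k != j -> tnth x k = tnth y k) ->
    tnth x j <= tnth y j -> g x <= g y.

(* Conditional probabilities given the past are only defined up to null sets;
   as usual for laws with full support (such as nondegenerate Gaussian ones)
   they are read as their continuous version, which is then unique. *)
Definition CIS X : Prop :=
  forall (i : 'I_m) (t : R), exists g : i.-tuple R -> R,
    [/\ cond_survival X t g, tuple_continuous g
      & coordinatewise_nondecreasing g].

End cis.

(* Main.v *)
Require Import Defs.
From mathcomp Require Import all_boot all_order all_algebra.
From mathcomp Require Import all_classical all_reals all_analysis.
From mathcomp Require Import measurable_realfun lra.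
Import Order.TTheory GRing.Theory Num.Theory.
Import numFieldNormedType.Exports.

(** Write [K = Sigma^-1]. A positive definite [K] is [U *m U^T] for some upper
    triangular [U] with positive diagonal ([posdefmx_upper_cholesky]), and then
    the quadratic form of [K] at [x - mu] is the sum of the squares of
    [(U^T *m (x - mu)) i = U i i * (x_i - mu_i)
                           + \sum_(j < i) U j i * (x_j - mu_j)].
    Since the [i]-th term depends on [x_0, .., x_i] only, the Gaussian density
    is a product of one-dimensional normal densities, the [i]-th one being
    that of [x_i] given its past, with a mean that is affine in the past and
    the constant standard deviation [1 / U i i] ([gaussian_pdf_seqdens]). So
    [P (X_i >= t | past)] is a normal tail at [t] minus that mean. The mean has
    slope [- U j i / U i i] in [x_j] and the tail is strictly decreasing:
    monotonicity in the past amounts to [U j i <= 0] for all [j < i]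
    ([gauss_survival_nondecreasing]).

    Two analytic facts turn this into a proof. First, a product of conditional
    densities really has its factors as conditional laws
    ([integral_seqdens_cond], [cond_survival_seqdens]): in the iterated
    integral the last coordinates come innermost and integrate to [1].
    Secondly, the continuous version of a conditional survival function is
    unique when the law has a positive density, because then every box has
    positive probability ([cond_survival_unique]); hence the version supplied
    by the CIS hypothesis is the explicit one. *)

Set Implicit Arguments.
Unset Strict Implicit.
Unset Printing Implicit Defensive.

Local Open Scope classical_set_scope.
Local Open Scope ring_scope.

(** * Integration against densities *)

(** Both [p] and the Radon-Nikodym derivative of [nu] integrate to [nu] on every
    measurable set, so they agree almost everywhere. *)
Lemma integral_density d (T : measurableType d) (R : realType)
    (mu : {sigma_finite_measure set T -> \bar R})
    (nu : {finite_measure set T -> \bar R}) (p : T -> R) (f : T -> \bar R)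
    (D : set T) :
  measurable_fun setT p -> (forall x, 0 <= p x) ->
  (forall A, measurable A -> nu A = (\int[mu]_(x in A) (p x)%:E)%E) ->
  measurable D -> nu.-integrable D f ->
  (\int[nu]_(x in D) f x = \int[mu]_(x in D) ((p x)%:E * f x))%E.
Proof.
move=> mp p0 nuE mD intf.
have mpE (A : set T) : measurable_fun A (EFin \o p).
  by apply/measurable_EFinP; exact: measurable_funTS.
have numu : nu `<< mu.
  by apply/null_content_dominatesP => A mA A0; rewrite nuE// null_set_integral.
have intp : mu.-integrable setT (EFin \o p).
  apply/integrableP; split; first exact: mpE.
  under eq_integral do rewrite /= ger0_norm//.
  by rewrite -nuE// ltey_eq fin_num_measure.
rewrite -(Radon_Nikodym_change_of_variables numu)//.
apply: ae_eq_integral => //.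
- apply: emeasurable_funM => //; first exact: measurable_int intf.
  exact/measurable_funTS/(measurable_int mu)/Radon_Nikodym_integrable.
- by apply: emeasurable_funM => //; exact: measurable_int intf.
under [X in ae_eq _ _ _ X]eq_fun do rewrite muleC.
apply: ae_eqe_mul2l; apply: integral_ae_eq => //.
- by apply: (integrableS measurableT) => //; exact: Radon_Nikodym_integrable.
- by move=> E _ mE; rewrite -nuE// -Radon_Nikodym_integral.
Qed.

Lemma integral_gt0 d (T : measurableType d) (R : realType)
    (mu : {measure set T -> \bar R}) (f : T -> R) (D : set T) :
  measurable D -> measurable_fun D f -> (forall x, D x -> 0 < f x) ->
  (0 < mu D)%E -> (0 < \int[mu]_(x in D) (f x)%:E)%E.
Proof.
move=> mD mf f0 D0; rewrite lt0e integral_ge0 ?andbT; last first.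
  by move=> x Dx; rewrite lee_fin ltW// f0.
apply/eqP => If0; move: D0.
have /(ae_eq_integral_abs mu mD) : measurable_fun D (EFin \o f).
  exact/measurable_EFinP.
case=> /(_ _)[].
  rewrite -If0; apply: eq_integral => x /set_mem Dx.
  by rewrite /= ger0_norm// ltW// f0.
move=> N [mN N0 subN] _; rewrite (@subset_measure0 _ _ _ mu D N) ?ltxx//.
move=> x Dx; apply: subN => /= /(_ Dx) [fx0].
by have := f0 _ Dx; rewrite fx0 ltxx.
Qed.

(** * Products of conditional densities *)

Lemma integral_tuple_lebesgueS (R : realType) n
    (f : n.+1.-tuple R -> \bar R) :
  measurable_fun setT f -> (forall x, (0 <= f x)%E) ->
  (\int[tuple_lebesgue n.+1]_x f x =
   \int[lebesgue_measure]_x \int[tuple_lebesgue n]_t f (tcons (x, t)))%E.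
Proof.
move=> mf f0.
rewrite /= /lebesgue_step ge0_integral_pushforward//=.
rewrite preimage_setT fubini_tonelli1//.
apply: measurableT_comp => //; exact: measurable_tcons.
Qed.

Section sequential_densities.
Context {R : realType}.
Implicit Types (q : seq R -> R -> R) (n : nat).

Definition tpast n (i : 'I_n) (x : n.-tuple R) : i.-tuple R :=
  [tuple tnth x (widen_ord (ltnW (ltn_ord i)) j) | j < i].

Lemma tpastE n (i : 'I_n) (x : n.-tuple R) : tpast i x = take i x :> seq R.
Proof.
apply: (@eq_from_nth _ 0) => [|j].
  by rewrite size_tuple size_take size_tuple ltn_ord.
rewrite size_tuple => ji; rewrite nth_take// -(tnth_nth _ _ (Ordinal ji)).
by rewrite tnth_mktuple (tnth_nth 0).
Qed.

Lemma measurable_tpast n (i : 'I_n) : measurable_fun setT (@tpast n i).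
Proof.
apply/measurable_fun_tnthP => j.
rewrite (_ : _ \o _ =
  (fun x => tnth x (widen_ord (ltnW (ltn_ord i)) j))); last first.
  by apply/funext => x /=; rewrite tnth_mktuple.
exact: measurable_tnth.
Qed.

Lemma measurable_tpast_tnth d (T : measurableType d) n (i : 'I_n)
    (f : seq R -> R -> T) :
  measurable_fun setT (fun z : i.-tuple R * measurableTypeR R => f z.1 z.2) ->
  measurable_fun setT (fun x : n.-tuple R => f (take i x) (tnth x i)).
Proof.
move=> mf; rewrite (_ : (fun x => _) =
   (fun z : i.-tuple R * measurableTypeR R => f z.1 z.2) \o
   (fun x : n.-tuple R => (tpast i x, tnth x i))); last first.
  by apply/funext => x /=; rewrite tpastE.
apply: measurableT_comp => //; apply: measurable_fun_pair.
- exact: measurable_tpast.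
- exact: measurable_tnth.
Qed.

(** [q s] stands for the density of the next coordinate when the coordinates
    read so far are [s]. Indexing by lists of all lengths makes the family
    closed under fixing the first coordinate ([shift_past]), which is what the
    inductions on the dimension use. *)
Definition cond_densities q : Prop :=
  [/\ forall s x, 0 <= q s x,
      forall s, (\int[lebesgue_measure]_x (q s x)%:E = 1)%E &
      forall n, measurable_fun setT
        (fun z : n.-tuple R * measurableTypeR R => q z.1 z.2)].

Definition shift_past A (f : seq R -> A) (x : R) : seq R -> A :=
  fun s => f (x :: s).

Lemma measurable_shift_past d (T : measurableType d) n (f : seq R -> R -> T) x :
  measurable_fun setT
    (fun z : n.+1.-tuple R * measurableTypeR R => f z.1 z.2) ->
  measurable_fun setT
    (fun z : n.-tuple R * measurableTypeR R => shift_past f x z.1 z.2).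
Proof.
move=> mf; rewrite (_ : (fun z => _) =
   (fun z : n.+1.-tuple R * measurableTypeR R => f z.1 z.2) \o
   (fun z : n.-tuple R * measurableTypeR R => ([tuple of x :: z.1], z.2)))//.
apply: measurableT_comp => //; apply: measurable_fun_pair => //.
exact: (measurable_cons (f := fun=> x)).
Qed.

Lemma cond_densities_shift q x : cond_densities q ->
  cond_densities (shift_past q x).
Proof.
case=> q0 q1 mq; split => [s y|s|n]; [exact: q0|exact: q1|].
by apply: (measurable_shift_past (f := q)); exact: mq n.+1.
Qed.

Definition seqdens q n (x : n.-tuple R) : R :=
  \prod_(i < n) q (take i x) (tnth x i).

Lemma seqdens_ge0 q n (x : n.-tuple R) : cond_densities q -> 0 <= seqdens q x.
Proof. by case=> q0 _ _; apply: prodr_ge0. Qed.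

Lemma measurable_seqdens q n : cond_densities q ->
  measurable_fun setT (@seqdens q n).
Proof.
case=> _ _ mq; apply: measurable_prod => i _.
by apply: (measurable_tpast_tnth (f := q)); exact: mq.
Qed.

Lemma seqdens_cons q n x (t : n.-tuple R) :
  seqdens q (tcons (x, t)) = q [::] x * seqdens (shift_past q x) t.
Proof.
rewrite /seqdens big_ord_recl; congr (q _ _ * _).
by apply: eq_bigr => i _; rewrite tnthS.
Qed.

Let mE q n : cond_densities q ->
  measurable_fun setT (fun x : n.-tuple R => (seqdens q x)%:E).
Proof. by move=> qP; apply/measurable_EFinP; exact: measurable_seqdens. Qed.

Let dens0 q n (x : n.-tuple R) : cond_densities q -> (0 <= (seqdens q x)%:E)%E.
Proof. by move=> qP; rewrite lee_fin seqdens_ge0. Qed.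

Lemma measurable_cond_density q s : cond_densities q ->
  measurable_fun setT (fun x : measurableTypeR R => (q s x)%:E).
Proof.
case=> _ _ /(_ (size s)) mq; apply/measurable_EFinP.
rewrite (_ : q s = (fun z : (size s).-tuple R * measurableTypeR R => q z.1 z.2)
  \o (fun x => (in_tuple s, x)))//.
by apply: measurableT_comp => //; apply: measurable_fun_pair.
Qed.

Lemma integral_seqdens_cons q n x (f : n.-tuple R -> \bar R) :
  cond_densities q -> measurable_fun setT f -> (forall t, (0 <= f t)%E) ->
  (\int[tuple_lebesgue n]_t ((seqdens q (tcons (x, t)))%:E * f t) =
   (q [::] x)%:E *
   \int[tuple_lebesgue n]_t ((seqdens (shift_past q x) t)%:E * f t))%E.
Proof.
move=> qP mf f0; have qxP := cond_densities_shift x qP.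
under eq_integral do rewrite seqdens_cons EFinM -muleA.
rewrite ge0_integralZl//.
- by apply: emeasurable_funM => //; exact: mE.
- by move=> t _; rewrite mule_ge0// dens0.
- by case: qP => q0 _ _; rewrite lee_fin.
Qed.

Lemma integral_seqdens q n : cond_densities q ->
  (\int[tuple_lebesgue n]_x (seqdens q x)%:E = 1)%E.
Proof.
elim: n q => [|n IHn] q qP.
  by rewrite integral_dirac ?diracT ?mul1e /seqdens ?big_ord0//; exact: mE.
rewrite integral_tuple_lebesgueS; [|exact: mE|by move=> x; exact: dens0].
rewrite -[RHS](let: And3 _ q1 _ := qP in q1 [::]); apply: eq_integral => x _.
under eq_integral do rewrite -[(seqdens _ _)%:E]mule1.
rewrite (@integral_seqdens_cons _ _ _ (cst 1%E))//.
under eq_integral do rewrite mule1.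
by rewrite IHn ?mule1//; exact: cond_densities_shift.
Qed.

Definition cond_expect q (h : seq R -> R -> \bar R) (s : seq R) : \bar R :=
  (\int[lebesgue_measure]_y ((q s y)%:E * h s y))%E.

Lemma cond_expect_ge0 q (h : seq R -> R -> \bar R) s : cond_densities q ->
  (forall s y, (0 <= h s y)%E) -> (0 <= cond_expect q h s)%E.
Proof.
case=> q0 _ _ h0; apply: integral_ge0 => y _.
by apply: mule_ge0 => //; rewrite lee_fin.
Qed.

Lemma measurable_cond_expect n q (h : seq R -> R -> \bar R) :
  cond_densities q -> (forall s y, (0 <= h s y)%E) ->
  measurable_fun setT (fun z : n.-tuple R * measurableTypeR R => h z.1 z.2) ->
  measurable_fun setT (fun s : n.-tuple R => cond_expect q h s).
Proof.
move=> [q0 _ mq] h0 mh; apply: (measurable_fun_fubini_tonelli_F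
  (fun z : n.-tuple R * measurableTypeR R => (q z.1 z.2)%:E * h z.1 z.2)%E).
- by apply: emeasurable_funM => //; apply/measurable_EFinP; exact: mq.
- by move=> z; apply: mule_ge0 => //; rewrite lee_fin.
Qed.

(** Only the coordinates after the [i]-th have to be integrated out before the
    [i]-th factor can be averaged, and these come innermost in the iterated
    integral; induction peels the coordinates before [i]. *)
Lemma integral_seqdens_cond n (i : 'I_n) q (h : seq R -> R -> \bar R) :
  cond_densities q -> (forall s y, (0 <= h s y)%E) ->
  measurable_fun setT
    (fun z : i.-tuple R * measurableTypeR R => h z.1 z.2) ->
  (\int[tuple_lebesgue n]_x ((seqdens q x)%:E * h (take i x) (tnth x i)) =
   \int[tuple_lebesgue n]_x ((seqdens q x)%:E * cond_expect q h (take i x)))%E.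
Proof.
elim: n i q h => [[]//|n IHn] i q h qP h0 mh.
have mhi := measurable_tpast_tnth mh.
have mai : measurable_fun setT
    (fun x : n.+1.-tuple R => cond_expect q h (take i x)).
  apply: (@measurable_tpast_tnth _ _ _ _ (fun s=> fun=> cond_expect q h s)).
  apply: (@measurableT_comp _ _ _ _ _ _
    (fun s : i.-tuple R => cond_expect q h s)).
    exact: measurable_cond_expect.
  exact: measurable_fst.
have cm0 s : (0 <= cond_expect q h s)%E by exact: cond_expect_ge0.
rewrite integral_tuple_lebesgueS; last 2 first.
- by apply: emeasurable_funM => //; exact: mE.
- by move=> x; rewrite mule_ge0// dens0.
rewrite [RHS]integral_tuple_lebesgueS; last 2 first.
- by apply: emeasurable_funM => //; exact: mE.
- by move=> x; rewrite mule_ge0// ?dens0//.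
(* The densities after the first coordinate integrate to [1]. *)
have q1 x (c : \bar R) : (0 <= c)%E ->
    (\int[tuple_lebesgue n]_t ((seqdens q (tcons (x, t)))%:E * c) =
     (q [::] x)%:E * c)%E.
  move=> c0; have qxP := cond_densities_shift x qP.
  rewrite (@integral_seqdens_cons _ _ _ (cst c))// ge0_integralZr//.
  + by rewrite integral_seqdens// mul1e.
  + exact: mE.
  + by move=> t _; exact: dens0.
have mtcons x : measurable_fun setT (fun t : n.-tuple R => tcons (x, t)).
  apply: (measurableT_comp (@measurable_tcons R n)).
  exact: measurable_fun_pair.
case: i mh mhi mai => -[|i] im mh mhi mai.
- transitivity (cond_expect q h [::]).
    by apply: eq_integral => x _; rewrite /= -q1.
  under [RHS]eq_integral do rewrite /= q1//.
  rewrite ge0_integralZr//.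
  + by case: qP => _ -> _; rewrite mul1e.
  + exact: measurable_cond_density.
  + by move=> x _; case: qP => q0 _ _; rewrite lee_fin.
- apply: eq_integral => x _ /=.
  have qxP := cond_densities_shift x qP.
  pose j : 'I_n := Ordinal (im : (i < n)%N).
  have := IHn j (shift_past q x) (shift_past h x) qxP.
  move=> /(_ (fun s => h0 (x :: s)) (measurable_shift_past (f := h) x mh)) IH.
  rewrite (@integral_seqdens_cons _ _ _
    (fun t => h (take i.+1 (tcons (x, t)))
                (tnth (tcons (x, t)) (Ordinal im))))//;
    last exact: (measurableT_comp mhi).
  rewrite [RHS](@integral_seqdens_cons _ _ _
    (fun t => cond_expect q h (take i.+1 (tcons (x, t)))))//;
    last exact: (measurableT_comp mai).
  congr (_ * _)%E; rewrite -[RHS]IH; apply: eq_integral => t _.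
  congr (_ * h _ _)%E.
  by rewrite (_ : Ordinal im = lift ord0 j) ?tnthS//; exact: val_inj.
Qed.

End sequential_densities.

Section conditional_law.
Context d (T : measurableType d) (R : realType) (P : probability T R) (n : nat).
Variables (X : {RV P >-> n.-tuple R}) (q : seq R -> R -> R).
Hypothesis qP : cond_densities q.
Hypothesis Xq : forall A : set (n.-tuple R), measurable A ->
  distribution P X A = (\int[tuple_lebesgue n]_(x in A) (seqdens q x)%:E)%E.

Lemma integral_law_seqdens (f : n.-tuple R -> R) (D : set (n.-tuple R)) :
  measurable D -> measurable_fun setT f -> (forall x, 0 <= f x <= 1) ->
  (\int[P]_(w in X @^-1` D) (f (X w))%:E =
   \int[tuple_lebesgue n]_(x in D) ((seqdens q x)%:E * (f x)%:E))%E.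
Proof.
move=> mD mf f01.
rewrite -(@integral_density _ _ _ _ (distribution P X) _ (EFin \o f))//.
- rewrite ge0_integral_pushforward//=.
  + by apply/measurable_EFinP; exact: measurable_funTS.
  + by move=> x _; rewrite lee_fin; case/andP: (f01 x).
- exact: measurable_seqdens.
- by move=> x; exact: seqdens_ge0.
- apply: measurable_bounded_integrable => //.
  + by rewrite ltey_eq fin_num_measure.
  + exact: measurable_funTS.
  + exists 1; split => // M M1 x _.
    by case/andP: (f01 x) => f0 f1; rewrite /= ger0_norm// (le_trans f1) ?ltW.
Qed.

(** This is [integral_seqdens_cond] for the test function
    [h past y = 1_B(past) * 1_(y >= t)], whose average over [y] is
    [1_B(past) * g past]. *)
Lemma cond_survival_seqdens (i : 'I_n) t (g : i.-tuple R -> R) :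
  (forall s : i.-tuple R, (g s)%:E =
    \int[lebesgue_measure]_(y in `[t, +oo[) (q s y)%:E)%E ->
  cond_survival X t g.
Proof.
move=> gE; case: (qP) => q0 q1 mq.
have mqs s : measurable_fun setT (fun y : measurableTypeR R => (q s y)%:E).
  exact: measurable_cond_density.
have g01 s : 0 <= g s <= 1.
  rewrite -!lee_fin gE integral_ge0//= -?(q1 s).
    apply: ge0_subset_integral => //.
    by move=> y _; rewrite lee_fin.
  by move=> y _; rewrite lee_fin.
have mI : measurable_fun setT (fun z : i.-tuple R * measurableTypeR R =>
    \1_`[t, +oo[ z.2 : R).
  by apply: (@measurableT_comp _ _ _ _ _ _
    (\1_`[t, +oo[ : measurableTypeR R -> R)).
have mg : measurable_fun setT g.
  apply/measurable_EFinP.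
  rewrite (_ : EFin \o g = (fun s : i.-tuple R =>
    cond_expect q (fun=> EFin \o \1_`[t, +oo[) s)).
    apply: measurable_cond_expect => //.
      by move=> s y; rewrite lee_fin.
    exact/measurable_EFinP.
  apply/funext => s; rewrite /= gE integral_mkcond /cond_expect.
  by apply: eq_integral => y _; rewrite epatch_indic.
split=> // B mB.
pose C : set (n.-tuple R) := @tpast R n i @^-1` B.
pose C' : set (n.-tuple R) := (fun x => tnth x i) @^-1` `[t, +oo[.
have mC : measurable C.
  by rewrite -[C]setTI; apply: measurable_tpast.
have mC' : measurable C'.
  by rewrite -[C']setTI; apply: measurable_tnth.
pose h (s : seq R) (y : R) : \bar R :=
  (\1_(val @` B : set (seq R)) s * \1_`[t, +oo[ y)%:E.
have hB (s : i.-tuple R) y : h s y = (\1_B s * \1_`[t, +oo[ y)%:E.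
  suff sB : (val s \in val @` B) = (s \in B) by rewrite /h !indicE sB.
  apply/idP/idP => /set_mem; last by move=> Bs; apply/mem_set; exists s.
  by case=> s' Bs' /val_inj ss'; apply/mem_set; rewrite -ss'.
transitivity (distribution P X (C `&` C')).
  congr (P _); apply/seteqP; split=> w /= [? tX]; split=> //.
    by rewrite /C' /= in_itv/= tX.
  by move: tX; rewrite /C' /= in_itv/= andbT.
rewrite Xq; last exact: measurableI.
rewrite -[past X i @^-1` B]/(X @^-1` C).
under [RHS]eq_integral do rewrite -[past X i _]/(tpast i (X _)).
rewrite (@integral_law_seqdens (g \o tpast i))//; last 2 first.
- by apply: (measurableT_comp mg); exact: measurable_tpast.
- by move=> x; exact: g01.
rewrite integral_mkcond [RHS]integral_mkcond.
transitivity (\int[tuple_lebesgue n]_x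
    ((seqdens q x)%:E * h (take i x) (tnth x i)))%E.
  apply: eq_integral => x _; rewrite -tpastE hB epatch_indic /= -EFinM.
  by rewrite indicI.
rewrite integral_seqdens_cond//; last 2 first.
- by move=> s y; rewrite lee_fin mulr_ge0.
- rewrite (_ : (fun z => _) = EFin \o (fun z : i.-tuple R * measurableTypeR R
    => \1_B z.1 * \1_`[t, +oo[ z.2)).
    apply/measurable_EFinP/measurable_funM => //.
    by apply: (@measurableT_comp _ _ _ _ _ _ (\1_B : i.-tuple R -> R)).
  by apply/funext => z; exact: hB.
have cond_expectE (s : i.-tuple R) :
    cond_expect q h s = ((g s)%:E * (\1_B s)%:E)%E.
  rewrite gE muleC -ge0_integralZl//; last 2 first.
  - exact: measurable_funTS.
  - by move=> y _; rewrite lee_fin.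
  rewrite [RHS]integral_mkcond; apply: eq_integral => y _.
  by rewrite epatch_indic /= hB EFinM muleCA muleA.
apply: eq_integral => x _; rewrite -tpastE cond_expectE epatch_indic.
by rewrite /= muleA.
Qed.

End conditional_law.

(** * Uniqueness of the continuous version *)

Section continuous_version.
Context {R : realType}.

Definition tuple_box n (a : n.-tuple R) (e : R) : set (n.-tuple R) :=
  [set x | forall j, `|tnth a j - tnth x j| < e].

Lemma measurable_tuple_box n (a : n.-tuple R) e : measurable (tuple_box a e).
Proof.
rewrite (_ : tuple_box a e =
  \bigcap_(j in [set: 'I_n]) ((fun x => tnth x j) @^-1` ball (tnth a j) e)).
  apply: fin_bigcap_measurable => // j _.
  rewrite -[X in measurable X]setTI; apply: measurable_tnth => //.
  exact: measurable_ball.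
by apply/seteqP; split=> [x xa j _|x xa j]; [exact: xa|exact: (xa j I)].
Qed.

Lemma tuple_lebesgue_box_gt0 n (a : n.-tuple R) e : 0 < e ->
  (0 < tuple_lebesgue n (tuple_box a e))%E.
Proof.
move=> e0; elim: n a => [|n IHn] a.
  by rewrite /= diracE mem_set// => -[].
rewrite /= /lebesgue_step /pushforward.
rewrite (_ : _ @^-1` _ =
   ball (tnth a ord0) e `*` tuple_box [tuple of behead a] e).
  rewrite product_measure1E//; last 2 first.
  - exact: measurable_ball.
  - exact: measurable_tuple_box.
  rewrite mule_gt0//.
  by rewrite /= lebesgue_measure_ball ?ltW// lte_fin mulrn_wgt0.
have aE j : tnth a (lift ord0 j) = tnth [tuple of behead a] j.
  by rewrite {1}(tuple_eta a) tnthS.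
apply/seteqP; split=> -[x t] /=.
- move=> xt; split=> [|j]; first exact: (xt ord0).
  by have := xt (lift ord0 j); rewrite aE tnthS.
- move=> [xa ta] j; case: (unliftP ord0 j) => [k|] ->; last exact: xa.
  by rewrite aE tnthS; exact: ta.
Qed.

Lemma tuple_continuous_box n (g : n.-tuple R -> R) (a : n.-tuple R) e :
  tuple_continuous g -> 0 < e ->
  exists2 r, 0 < r & forall x, tuple_box a r x -> `|g a - g x| < e.
Proof.
move=> cg e0; pose row (x : n.-tuple R) : 'rV[R]_n := \row_j tnth x j.
have rowK x : [tuple row x ord0 j | j < n] = x.
  by apply: eq_from_tnth => j; rewrite tnth_mktuple mxE.
have /cvgrPdist_lt/(_ _ e0)/nbhs_ballP[r /= r0 ar] := cg (row a).
exists r => // x xa; have := ar (row x).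
rewrite !rowK; apply; split => // i j.
by rewrite !mxE; exact: xa.
Qed.

(** If [g1 a < g2 a], then by continuity [g1 < g2] on a box around [a]. The
    past falls into that box with positive probability, while [g1] and [g2]
    have the same integral over this event. *)
Lemma cond_survival_unique d (T : measurableType d) (P : probability T R) n
    (X : {RV P >-> n.-tuple R}) (p : n.-tuple R -> R) :
  measurable_fun setT p -> (forall x, 0 < p x) ->
  (forall A, measurable A ->
    distribution P X A = (\int[tuple_lebesgue n]_(x in A) (p x)%:E)%E) ->
  forall (i : 'I_n) t (g1 g2 : i.-tuple R -> R),
    cond_survival X t g1 -> tuple_continuous g1 ->
    cond_survival X t g2 -> tuple_continuous g2 -> g1 =1 g2.
Proof.
move=> mp p0 Xp i t g1 g2 S1 c1 S2 c2 a.
wlog suff H : g1 g2 S1 c1 S2 c2 / ~~ (g1 a < g2 a).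
  by apply/eqP; rewrite eq_le !leNgt !H.
apply/negP => g12; pose e := (g2 a - g1 a) / 2.
have e0 : 0 < e by rewrite divr_gt0// subr_gt0.
have [r1 r10 b1] := tuple_continuous_box a c1 e0.
have [r2 r20 b2] := tuple_continuous_box a c2 e0.
pose r := Num.min r1 r2.
have r0 : 0 < r by rewrite lt_min r10.
pose B := tuple_box a r.
have mB : measurable B by exact: measurable_tuple_box.
have B1 x : B x -> `|g1 a - g1 x| < e.
  by move=> Bx; apply: b1 => j; rewrite (lt_le_trans (Bx j))// ge_min lexx.
have B2 x : B x -> `|g2 a - g2 x| < e.
  by move=> Bx; apply: b2 => j; rewrite (lt_le_trans (Bx j))// ge_min lexx orbT.
pose D := past X i @^-1` B.
have mpast : measurable_fun setT (past X i).
  rewrite (_ : past X i = tpast i \o X)//.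
  by apply: measurableT_comp; [exact: measurable_tpast|exact: measurable_funPT].
have mD : measurable D by rewrite -[D]setTI; exact: mpast.
have D0 : (0 < P D)%E.
  (* [b] extends [a] by zeros: any extension would do, as the box around it
     only has to project into [B]. *)
  pose b : n.-tuple R := [tuple a`_j | j < n].
  have mb : measurable (tuple_box b r) by exact: measurable_tuple_box.
  apply: (@lt_le_trans _ _ (distribution P X (tuple_box b r))).
    rewrite Xp//; apply: integral_gt0 => //.
    - exact: measurable_funTS.
    - exact: tuple_lebesgue_box_gt0.
  rewrite /distribution /pushforward; apply: le_measure; rewrite ?inE//.
    by rewrite -[_ @^-1` _]setTI; exact: (measurable_funPT X).
  move=> w /= bw j; have := bw (widen_ord (ltnW (ltn_ord i)) j).
  by rewrite /b /past !tnth_mktuple (tnth_nth 0 a).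
have Doo : (P D < +oo)%E by rewrite ltey_eq fin_num_measure.
have intg g : cond_survival X t g -> (forall x, B x -> `|g a - g x| < e) ->
    P.-integrable D (EFin \o (g \o past X i)).
  move=> [mg _] Bg; apply: measurable_bounded_integrable => //.
    by apply: measurable_funTS; exact: measurableT_comp.
  exists (`|g a| + e); split; first exact: num_real.
  move=> M M1 w /= Dw; rewrite (le_trans _ (ltW M1))//.
  rewrite -[X in `|X|](subKr (g a)) (le_trans (ler_normB _ _))// lerD2l.
  by rewrite ltW// Bg.
have i1 := intg _ S1 B1; have i2 := intg _ S2 B2.
have : (\int[P]_(w in D) (g2 (past X i w) - g1 (past X i w))%:E = 0)%E.
  rewrite (integralB_EFin mD i2 i1) /=.
  case: S1 => _ /(_ B mB) <-; case: S2 => _ /(_ B mB) <-.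
  rewrite subee// fin_num_measure//; apply: measurableI => //.
  rewrite (_ : mkset _ = (fun w => tnth (X w) i) @^-1` `[t, +oo[).
    rewrite -[_ @^-1` _]setTI.
    have : measurable_fun setT (fun w => tnth (X w) i).
      apply: (@measurableT_comp _ _ _ _ _ _ (fun x => tnth x i)).
        exact: measurable_tnth.
      exact: measurable_funPT.
    by apply => //; exact: measurable_itv.
  by apply/seteqP; split=> w /=; rewrite in_itv/= andbT.
apply/eqP; rewrite gt_eqF//; apply: integral_gt0 => //.
  case: S1 => m1 _; case: S2 => m2 _.
  by apply: measurable_funTS; apply: measurable_funB; exact: measurableT_comp.
move=> w Dw; have := B1 _ Dw; have := B2 _ Dw.
rewrite !ltr_norml /e => /andP[_ +] /andP[+ _]; lra.
Qed.

End continuous_version.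

(** * Tails of the normal law *)

Section normal_tail.
Context {R : realType}.
Implicit Types (s a b m t : R).

Definition normal_tail s a : R := fine (normal_prob 0 s `[a, +oo[).

Lemma normal_tailE s a : (normal_tail s a)%:E = normal_prob 0 s `[a, +oo[.
Proof. by rewrite fineK// fin_num_measure. Qed.

Lemma lebesgue_measure_shift m (A : set R) : measurable A ->
  pushforward lebesgue_measure (center m : _ -> measurableTypeR R) A =
  lebesgue_measure A.
Proof.
move=> mA; apply/esym.
have mc : measurable_fun setT
    (center m : measurableTypeR R -> measurableTypeR R).
  exact: measurable_funB.
apply: lebesgue_measure_unique => //= _ [[a b]] _ <-.
rewrite /pushforward (_ : center m @^-1` _ = `]a + m, b + m]%classic).
  rewrite !lebesgue_measure_itv/= !lte_fin ltrD2r -!EFinB.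
  by rewrite opprD addrACA subrr addr0.
by apply/seteqP; split=> x /=; rewrite !in_itv/= ltrBrDr lerBlDr.
Qed.

(** A change of mean is a translation of Lebesgue measure. *)
Lemma normal_prob_tail m s t : s != 0 ->
  (\int[lebesgue_measure]_(x in `[t, +oo[) (normal_pdf m s x)%:E =
  (normal_tail s (t - m))%:E)%E.
Proof.
move=> s0; rewrite normal_tailE /normal_prob.
have pdfE : normal_pdf m s = normal_pdf 0 s \o center m.
  by rewrite !normal_pdfE//; apply/funext => x; rewrite /= normal_fun_center.
pose c : measurableTypeR R -> measurableTypeR R := center m.
have -> : `[t, +oo[%classic = c @^-1` `[t - m, +oo[%classic.
  by apply/seteqP; split=> x /=; rewrite !in_itv/= !andbT lerD2r.
rewrite pdfE; transitivity (\int[pushforward lebesgue_measure c]_(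
    x in `[(t - m)%R, +oo[) (EFin \o normal_pdf 0 s) x)%E.
  apply/esym/ge0_integral_pushforward => //.
  - exact: measurable_funB.
  - by apply/measurable_EFinP/measurable_funTS; exact: measurable_normal_pdf.
  - by move=> x _; rewrite lee_fin normal_pdf_ge0.
apply: eq_measure_integral => /= [|mc A mA _]; first exact: measurable_funB.
exact: lebesgue_measure_shift.
Qed.

Lemma normal_tailB s a b : a <= b ->
  (normal_tail s a - normal_tail s b)%:E = normal_prob 0 s `[a, b[.
Proof.
move=> ab; rewrite EFinB !normal_tailE.
have -> : `[a, +oo[%classic = `[a, b[%classic `|` `[b, +oo[%classic.
  by apply: itv_bndbnd_setU; rewrite bnd_simp.
rewrite measureU ?addeK//.
- exact: fin_num_measure.
- apply/seteqP; split=> x //= []; rewrite !in_itv/= andbT => /andP[_ xb] bx.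
  by have := lt_le_trans xb bx; rewrite ltxx.
Qed.

Lemma normal_tail_lt s a b : s != 0 -> a < b ->
  normal_tail s b < normal_tail s a.
Proof.
move=> s0 ab; rewrite -subr_gt0 -lte_fin normal_tailB ?ltW//.
apply: integral_gt0 => //.
- by apply: measurable_funTS; exact: measurable_normal_pdf.
- by move=> x _; rewrite normal_pdfE// mulr_gt0 ?normal_peak_gt0// expR_gt0.
- by rewrite /= lebesgue_measure_itv/= lte_fin ab -EFinB lte_fin subr_gt0.
Qed.

Lemma normal_tail_le s a b : s != 0 ->
  (normal_tail s a <= normal_tail s b) = (b <= a).
Proof.
move=> s0; have [ba|ab|->] := ltgtP b a; rewrite ?lexx//.
- by rewrite ltW// normal_tail_lt.
- by apply/negbTE; rewrite -ltNge normal_tail_lt.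
Qed.

(** The increment is the integral, over the interval between [a] and [b], of
    a density that is bounded by its peak. *)
Lemma normal_tail_lipschitz s a b : s != 0 ->
  `|normal_tail s a - normal_tail s b| <= normal_peak s * `|a - b|.
Proof.
move=> s0; wlog ab : a b / a <= b.
  move=> H; have [/H//|/ltW/H] := leP a b.
  by rewrite distrC (distrC b).
rewrite ger0_norm ?subr_ge0 ?normal_tail_le//.
rewrite distrC ger0_norm ?subr_ge0// -lee_fin normal_tailB//.
apply: (@le_trans _ _
  (\int[lebesgue_measure]_(x in `[a, b[) (normal_peak s)%:E)%E).
  apply: ge0_le_integral => //.
  - by move=> x _; rewrite lee_fin normal_pdf_ge0.
  - by apply/measurable_EFinP/measurable_funTS; exact: measurable_normal_pdf.
  - by move=> x _; rewrite lee_fin normal_pdf_ub.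
rewrite integral_cst//= lebesgue_measure_itv/= lte_fin.
case: ifP => [_|/negbT]; first by rewrite -EFinB -EFinM.
rewrite -leNgt => ba; rewrite mule0 lee_fin.
by rewrite mulr_ge0 ?normal_peak_ge0 ?subr_ge0.
Qed.

Lemma continuous_normal_tail s : s != 0 -> continuous (normal_tail s).
Proof.
move=> s0 a; apply/cvgrPdist_lt => e e0; near=> b.
rewrite (le_lt_trans (normal_tail_lipschitz _ _ s0))//.
rewrite -ltr_pdivlMl ?normal_peak_gt0//.
near: b; apply/nbhs_ballP; exists ((normal_peak s)^-1 * e) => //=.
by rewrite mulr_gt0// invr_gt0 normal_peak_gt0.
Unshelve. all: by end_near. Qed.

End normal_tail.

(** * Upper triangular Cholesky factorisation *)

Section upper_cholesky.
Context {R : realType}.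

Lemma posdefmx_unit m (S : 'M[R]_m) : posdefmx S -> S \in unitmx.
Proof.
case=> St Sp; rewrite unitmxE unitfE; apply/negP => /det0P[v v0 vS].
have := Sp v^T; rewrite trmx_eq0 => /(_ v0).
by rewrite trmxK vS mul0mx mxE ltxx.
Qed.

Lemma posdefmx_inv m (S : 'M[R]_m) : posdefmx S -> posdefmx (invmx S).
Proof.
move=> Sp; have uS := posdefmx_unit Sp; case: Sp => St Sp.
have tiS : (invmx S)^T = invmx S by rewrite trmx_inv St.
split=> // v v0.
have := Sp (invmx S *m v); rewrite trmx_mul tiS -!mulmxA mulKVmx//; apply.
by apply: contra v0 => /eqP iv0; rewrite -(mulKVmx uS v) iv0 mulmx0.
Qed.

Lemma det_upper_trig m (U : 'M[R]_m) :
  (forall i j : 'I_m, (j < i)%N -> U i j = 0) ->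
  \det U = \prod_i U i i.
Proof.
move=> Ut; rewrite -det_tr det_trig.
  by apply: eq_bigr => i _; rewrite mxE.
by apply/is_trig_mxP => i j ij; rewrite mxE Ut.
Qed.

(** The trailing block is positive definite, hence [U' *m U'^T] by induction.
    Clearing the first row and column with [B] leaves the pivot [r], which is
    positive since it is the value of the quadratic form at the vector that
    [B^T] sends to the first basis vector. *)
Lemma posdefmx_upper_cholesky m (K : 'M[R]_m) : posdefmx K ->
  exists U : 'M[R]_m,
    [/\ forall i j : 'I_m, (j < i)%N -> U i j = 0,
        forall i : 'I_m, 0 < U i i
      & K = U *m U^T].
Proof.
elim: m K => [|m IHm] K.
  move=> _; exists 0; split=> [[]//|[]//|].
  by rewrite [LHS]flatmx0 [RHS]flatmx0.
rewrite -[m.+1]/(1 + m)%N in K * => -[Kt Kp].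
pose K' := drsubmx K; pose b := dlsubmx K.
have KE : K = block_mx (ulsubmx K) b^T b K'.
  by rewrite -{1}(submxK K) /b trmx_dlsub Kt.
have [|U' [U'0 U'p K'E]] := IHm K'.
  split; first by rewrite /K' trmx_drsub Kt.
  move=> v v0; have := Kp (col_mx 0 v); rewrite col_mx_eq0 eqxx (negbTE v0).
  rewrite KE tr_col_mx mul_row_block mul_row_col.
  by rewrite !(trmx0, mulmx0, mul0mx, add0r); apply.
have uU' : U' \in unitmx.
  rewrite unitmxE det_upper_trig// unitfE; apply/prodf_neq0 => i _.
  by rewrite gt_eqF.
pose w : 'rV[R]_m := (invmx U' *m b)^T.
have wU : U' *m w^T = b by rewrite trmxK mulKVmx.
pose r := ulsubmx K - w *m w^T.
pose B : 'M[R]_(1 + m) := block_mx 1%:M w 0 U'.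
have KB : K = B *m block_mx r 0 0 1%:M *m B^T.
  rewrite {1}KE /B tr_block_mx !mulmx_block.
  rewrite !(mulmx0, mul0mx, mulmx1, mul1mx, trmx0, trmx1, addr0, add0r).
  rewrite subrK wU K'E; congr block_mx.
  by rewrite -wU trmx_mul trmxK.
have uB : B \in unitmx.
  by rewrite unitmxE det_ublock det1 mul1r -unitmxE.
have r0 : 0 < r ord0 ord0.
  pose e : 'cV[R]_(1 + m) := col_mx 1%:M 0.
  have := Kp (invmx B^T *m e).
  have -> : (invmx B^T *m e)^T *m K *m (invmx B^T *m e) = r.
    rewrite KB trmx_mul trmx_inv trmxK !mulmxA mulmxKV//.
    rewrite -(mulmxA _ B^T) mulmxV ?unitmx_tr// mulmx1 -mulmxA.
    rewrite /e mul_block_col tr_col_mx mul_row_col.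
    by rewrite !(mulmx0, mul0mx, mulmx1, mul1mx, trmx0, trmx1, addr0, add0r).
  apply; apply/eqP => /(congr1 (mulmx B^T)).
  rewrite mulKVmx ?unitmx_tr// mulmx0 => /matrixP/(_ (lshift m ord0) ord0).
  by rewrite /e col_mxEu !mxE/= => /eqP; rewrite oner_eq0.
exists (block_mx (Num.sqrt (r ord0 ord0))%:M w 0 U'); split.
- move=> i j; case: (split_ordP i) => i' ->; case: (split_ordP j) => j' ->.
  + by rewrite !ord1.
  + by rewrite /= !ord1.
  + by rewrite block_mxEdl mxE.
  + by rewrite block_mxEdr /= ltn_add2l => /U'0.
- move=> i; case: (split_ordP i) => i' ->.
  + by rewrite block_mxEul ord1 mxE eqxx sqrtr_gt0.
  + by rewrite block_mxEdr.
- rewrite {1}KE tr_block_mx mulmx_block.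
  rewrite !(mulmx0, mul0mx, trmx0, addr0, add0r).
  rewrite wU K'E; congr block_mx; last by rewrite -wU trmx_mul trmxK.
  rewrite tr_scalar_mx -scalar_mxM -expr2 sqr_sqrtr ?ltW//.
  by rewrite -mx11_scalar subrK.
Qed.

End upper_cholesky.

(** * Conditional laws of a Gaussian vector *)

Section gaussian_conditionals.
Context {R : realType} (m : nat) (mu : 'cV[R]_m) (U : 'M[R]_m).

(** The conditional mean of [X_i] given a past [s]: for [U] upper triangular,
    the value of [x_i] at which the [i]-th entry of [U^T *m (x - mu)] vanishes
    when [s] lists the earlier entries of [x]. *)
Definition cond_center (i : 'I_m) (s : seq R) : R :=
  mu i 0 - (U i i)^-1 * \sum_(j < m | (j < i)%N) U j i * (s`_j - mu j 0).

(** The standard normal default makes this a probability density for pasts of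
    every length, as [cond_densities] requires. *)
Definition gauss_cond (s : seq R) (y : R) : R :=
  if insub (size s) is Some i
  then normal_pdf (cond_center i s) (U i i)^-1 y else normal_pdf 0 1 y.

Lemma gauss_condE (i : 'I_m) s y : size s = i ->
  gauss_cond s y = normal_pdf (cond_center i s) (U i i)^-1 y.
Proof. by move=> si; rewrite /gauss_cond si valK. Qed.

Lemma measurable_tuple_nth n k :
  measurable_fun setT (fun x : n.-tuple R => x`_k).
Proof.
have [kn|nk] := ltnP k n.
- rewrite (_ : (fun x => _) = (fun x : n.-tuple R => tnth x (Ordinal kn))).
    exact: measurable_tnth.
  by apply/funext => x; rewrite (tnth_nth 0).
- rewrite (_ : (fun x => _) = cst 0)//.
  by apply/funext => x; rewrite nth_default// size_tuple.
Qed.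

Lemma measurable_cond_center n (i : 'I_m) :
  measurable_fun setT (fun s : n.-tuple R => cond_center i s).
Proof.
apply: measurable_funB => //; apply: measurable_funM => //.
under eq_fun do rewrite big_mkcond.
apply: measurable_sum => j; case: (j < i)%N => //; apply: measurable_funM => //.
by apply: measurable_funB => //; exact: measurable_tuple_nth.
Qed.

Hypothesis U_gt0 : forall i, 0 < U i i.

Let U_neq0 i : U i i != 0. Proof. by rewrite gt_eqF. Qed.
Let Ui_neq0 i : (U i i)^-1 != 0. Proof. by rewrite invr_eq0. Qed.

Lemma gauss_cond_densities : cond_densities gauss_cond.
Proof.
split=> [s x|s|n].
- by rewrite /gauss_cond; case: insub => [i|]; exact: normal_pdf_ge0.
- by rewrite /gauss_cond; case: insub => [i|]; exact: integral_normal_pdf.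
rewrite /gauss_cond; under eq_fun do rewrite size_tuple.
case: insub => [i|]; last first.
  by apply: (measurableT_comp (measurable_normal_pdf _ _)).
under eq_fun do rewrite normal_pdfE//.
apply: measurable_funM => //; apply: measurableT_comp => //.
apply: measurable_funM => //; apply: measurableT_comp => //.
apply: measurable_funX; apply: measurable_funB => //.
by apply: (measurableT_comp (measurable_cond_center _)).
Qed.

Hypothesis U_trig : forall i j : 'I_m, (j < i)%N -> U i j = 0.

Lemma trmul_upper_trig (y : 'cV[R]_m) i : (U^T *m y) i 0 =
  U i i * y i 0 + \sum_(j < m | (j < i)%N) U j i * y j 0.
Proof.
rewrite mxE; under eq_bigr do rewrite mxE.
rewrite (bigID (fun j : 'I_m => (j < i)%N)) addrC /=; congr (_ + _).
rewrite (bigD1 i) ?ltnn//= big1 ?addr0// => j /andP[ij ji].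
by rewrite U_trig ?mul0r// ltn_neqAle leqNgt ij andbT eq_sym.
Qed.

(** [(U^T *m (x - mu)) i] is [U i i] times the deviation of [x_i] from its
    conditional mean, that is, this deviation in units of the standard
    deviation. *)
Lemma gauss_cond_take (x : m.-tuple R) (i : 'I_m) :
  gauss_cond (take i x) (tnth x i) = (Num.sqrt (pi *+ 2))^-1 * U i i *
    expR (- ((U^T *m (\col_j tnth x j - mu)) i 0) ^+ 2 / 2).
Proof.
rewrite (@gauss_condE i) ?size_take ?size_tuple ?ltn_ord//.
rewrite normal_pdfE//; congr (_ * _).
- rewrite /normal_peak -mulrnAr sqrtrM ?sqr_ge0// sqrtr_sqr.
  by rewrite ger0_norm ?invr_ge0 1?ltW// invfM invrK mulrC.
- rewrite /normal_fun trmul_upper_trig; congr expR.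
  rewrite !mulNr; congr (- _).
  rewrite -mulr_natr invfM exprVn invrK mulrA -exprMn; congr (_ ^+ 2 / _).
  rewrite mulrC !mxE /cond_center opprB addrA addrAC mulrDr.
  rewrite mulrA divff// mul1r; congr (_ + _).
  apply: eq_bigr => j ji; rewrite !mxE nth_take//.
  by rewrite -tnth_nth.
Qed.

(** The normalising constants agree because [\det Sigma] is the inverse square
    of the product of the diagonal of [U], the exponents because
    [(x - mu)^T *m K *m (x - mu)] is the squared norm of [U^T *m (x - mu)]. *)
Lemma gaussian_pdf_seqdens (Sigma : 'M[R]_m) (x : m.-tuple R) :
  Sigma \in unitmx -> invmx Sigma = U *m U^T ->
  gaussian_pdf mu Sigma x = seqdens gauss_cond x.
Proof.
move=> uS SU; rewrite /gaussian_pdf /seqdens.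
under eq_bigr do rewrite gauss_cond_take.
rewrite big_split/= -expR_sum; congr (_ * expR _).
- have detS : \det Sigma = (\prod_i U i i) ^- 2.
    rewrite -[LHS]invrK -det_inv SU det_mulmx det_tr det_upper_trig//.
  have pU : 0 < \prod_i U i i by apply: prodr_gt0.
  have p0 : (0 : R) <= pi *+ 2 by rewrite mulrn_wge0// pi_ge0.
  rewrite big_split/= prodr_const card_ord detS sqrtrM ?exprn_ge0//.
  rewrite -exprVn sqrtr_sqr ger0_norm ?invr_ge0 1?ltW// invfM invrK exprVn.
  congr (_^-1 * _); elim: m => [|n IHn]; first by rewrite !expr0 sqrtr1.
  by rewrite !exprS sqrtrM// IHn.
- rewrite -mulr_suml SU; congr (_ / _); set y := _ - mu.
  have -> : y^T *m (U *m U^T) *m y = (U^T *m y)^T *m (U^T *m y).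
    by rewrite trmx_mul trmxK !mulmxA.
  by rewrite mxE -sumrN; apply: eq_bigr => i _; rewrite mxE -expr2.
Qed.

End gaussian_conditionals.

Section gaussian_survival.
Context {R : realType} (m : nat) (mu : 'cV[R]_m) (U : 'M[R]_m).
Hypothesis U_gt0 : forall i, 0 < U i i.

Let Ui_neq0 i : (U i i)^-1 != 0. Proof. by rewrite invr_eq0 gt_eqF. Qed.

Definition gauss_survival (i : 'I_m) (t : R) (s : i.-tuple R) : R :=
  normal_tail (U i i)^-1 (t - cond_center mu U i s).

Lemma gauss_survivalE (i : 'I_m) t (s : i.-tuple R) :
  (gauss_survival t s)%:E =
  (\int[lebesgue_measure]_(y in `[t, +oo[) (gauss_cond mu U s y)%:E)%E.
Proof.
rewrite -normal_prob_tail//; apply: eq_integral => y _.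
by rewrite (@gauss_condE _ _ _ _ i) ?size_tuple.
Qed.

Lemma cvg_cond_center T (F : set_system T) (FF : Filter F) (i : 'I_m)
    (s : T -> seq R) (l : seq R) :
  (forall j : 'I_m, (j < i)%N -> (s w)`_j @[w --> F] --> l`_j) ->
  cond_center mu U i (s w) @[w --> F] --> cond_center mu U i l.
Proof.
move=> sl; apply: (@cvgB _ R^o); first exact: cvg_cst.
apply: cvgM; first exact: cvg_cst.
apply: cvg_big => [|j ji]; first exact: add_continuous.
apply: cvgM; first exact: cvg_cst.
by apply: (@cvgB _ R^o); [exact: sl|exact: cvg_cst].
Qed.

Lemma continuous_gauss_survival (i : 'I_m) t :
  tuple_continuous (@gauss_survival i t).
Proof.
move=> v; apply: (@cvg_comp _ _ _ _ (normal_tail (U i i)^-1) _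
  (nbhs (t - cond_center mu U i [tuple v ord0 j | j < i]))); last first.
  exact: continuous_normal_tail.
apply: (@cvgB _ R^o _ (nbhs v) (nbhs_filter v)); first exact: cvg_cst.
apply: (@cvg_cond_center _ (nbhs v) (nbhs_filter v)) => j ji.
have nthE (w : 'rV[R]_i) :
    [tuple w ord0 k | k < i]`_j = w ord0 (Ordinal ji).
  by rewrite -(tnth_nth 0 _ (Ordinal ji)) tnth_mktuple.
rewrite nthE (_ : (fun w : 'rV[R]_i => _) =
  (fun w : 'rV[R]_i => w ord0 (Ordinal ji))); first exact: coord_continuous.
by apply/funext => w; exact: nthE.
Qed.

(** The survival function increases with the conditional mean, whose slope
    in the [j]-th coordinate is [- U j i / U i i]. *)
Lemma gauss_survival_nondecreasing (i : 'I_m) t :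
  coordinatewise_nondecreasing (@gauss_survival i t) <->
  forall j : 'I_m, (j < i)%N -> U j i <= 0.
Proof.
split=> [H j ji|H j x y xy xyj].
  (* Comparing the origin with the [j]-th unit vector isolates [U j i]. *)
  pose x : i.-tuple R := [tuple 0 | _ < i].
  pose y : i.-tuple R := [tuple (k == Ordinal ji)%:R | k < i].
  have xy k : k != Ordinal ji -> tnth x k = tnth y k.
    by rewrite !tnth_mktuple => /negbTE ->.
  have := H (Ordinal ji) x y xy; rewrite !tnth_mktuple eqxx => /(_ ler01).
  rewrite normal_tail_le// lerD2l lerN2 /cond_center lerD2l lerN2.
  rewrite ler_pM2l ?invr_gt0//.
  rewrite -subr_le0 -sumrB (bigD1 j)//= big1 => [|k /andP[ki kj]].
    have -> : x`_j = 0 by rewrite -(tnth_nth 0 _ (Ordinal ji)) tnth_mktuple.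
    have -> : y`_j = 1.
      by rewrite -(tnth_nth 0 _ (Ordinal ji)) tnth_mktuple eqxx.
    by rewrite addr0 -mulrBr opprB addrA subrK subr0 mulr1.
  have -> : x`_k = 0 by rewrite -(tnth_nth 0 _ (Ordinal ki)) tnth_mktuple.
  have -> : y`_k = 0.
    rewrite -(tnth_nth 0 _ (Ordinal ki)) tnth_mktuple.
    by rewrite (_ : (_ == _) = false)//; exact: negbTE.
  by rewrite subrr.
rewrite normal_tail_le// lerD2l lerN2 /cond_center lerD2l lerN2.
rewrite ler_pM2l ?invr_gt0//; apply: ler_sum => k ki.
rewrite ler_wnM2l ?H// lerD2r -!(tnth_nth 0 _ (Ordinal ki)).
by have [->//|/xy ->] := eqVneq (Ordinal ki) j.
Qed.

End gaussian_survival.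

(** * The characterisation *)

Theorem corollary2p3 (R : realType) (d : measure_display)
    (T : measurableType d) (P : probability T R) (m : nat)
    (X : {RV P >-> m.-tuple R}) (mu : 'cV[R]_m) (Sigma : 'M[R]_m)
    (hSigma : posdefmx Sigma) (hX : gaussian_vector X mu Sigma) :
  CIS X <->
  exists U : 'M[R]_m,
    [/\ forall i j : 'I_m, (j < i)%N -> U i j = 0,
        forall i : 'I_m, 0 < U i i,
        forall i j : 'I_m, i != j -> U i j <= 0
      & invmx Sigma = U *m U^T].
Proof.
have uS := posdefmx_unit hSigma.
have law (U : 'M[R]_m) : (forall i j : 'I_m, (j < i)%N -> U i j = 0) ->
    (forall i : 'I_m, 0 < U i i) -> invmx Sigma = U *m U^T ->
    forall A : set (m.-tuple R), measurable A -> distribution P X A =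
      (\int[tuple_lebesgue m]_(x in A) (seqdens (gauss_cond mu U) x)%:E)%E.
  move=> Ut Up SU A mA; rewrite hX//; apply: eq_integral => x _.
  by rewrite (gaussian_pdf_seqdens mu Up Ut _ uS).
have surv (U : 'M[R]_m) : (forall i j : 'I_m, (j < i)%N -> U i j = 0) ->
    (forall i : 'I_m, 0 < U i i) -> invmx Sigma = U *m U^T ->
    forall (i : 'I_m) t, cond_survival X t (@gauss_survival R m mu U i t).
  move=> Ut Up SU i t; apply: (cond_survival_seqdens (q := gauss_cond mu U)).
  - exact: gauss_cond_densities.
  - exact: law.
  - by move=> s; exact: gauss_survivalE.
split=> [cisX|[U [Ut Up Un SU]] i t].
- have [U [Ut Up SU]] := posdefmx_upper_cholesky (posdefmx_inv hSigma).
  exists U; split=> // i j; rewrite neq_ltn => /orP[ij|/Ut->//].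
  have [g [Sg cg ng]] := cisX j 0.
  suff gE : g =1 gauss_survival mu U 0.
    apply: (gauss_survival_nondecreasing mu Up j 0).1 => // k x y xy xyk.
    by rewrite -!gE; exact: ng xy xyk.
  have qP := gauss_cond_densities mu Up.
  have pos x : 0 < seqdens (gauss_cond mu U) (x : m.-tuple R).
    apply: prodr_gt0 => k _; rewrite gauss_cond_take//.
    by rewrite !mulr_gt0 ?expR_gt0// invr_gt0 sqrtr_gt0 mulrn_wgt0// pi_gt0.
  exact: (cond_survival_unique (measurable_seqdens qP) pos (law U Ut Up SU)
    Sg cg (surv U Ut Up SU j 0) (@continuous_gauss_survival _ _ _ _ Up j 0)).
- exists (@gauss_survival R m mu U i t); split.
  + exact: surv.
  + exact: continuous_gauss_survival.
  + apply/gauss_survival_nondecreasing => // j ji.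
    by apply: Un; rewrite neq_ltn ji.
Qed.
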